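(* Let $X$ be a Banach space. If $c_0$ coarse Lipschitz embeds into the dual space $X^*$ with coarse Lipschitz distortion strictly less than $\frac32$, then $X$ contains an isomorphic copy of $\ell_1$.
   Context: Let $X,Y$ be Banach spaces. A map $f:X\to Y$ is a coarse Lipschitz embedding if there are $A,B,C,D>0$ with $A\|x-y\|-C\le\|f(x)-f(y)\|\le B\|x-y\|+D$ for all $x,y\in X$. A coarse Lipschitz embedding $f:X\to Y$ has coarse Lipschitz distortion strictly less than $K$ if there exist $A,B,C,D>0$ with $AC<K$ such that $$\tfrac1A\|x-y\|-B\le\|f(x)-f(y)\|\le C\|x-y\|+D\quad\text{for all }x,y\in X.$$ *)

(* Defs.v *)
From HB Require Import structures.
From mathcomp Require Import all_boot all_order all_algebra.
From mathcomp Require Import boolp classical_sets functions reals.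
From mathcomp Require Import topology normedtype sequences.

Set Implicit Arguments.
Unset Strict Implicit.
Unset Printing Implicit Defensive.

Import Order.TTheory GRing.Theory Num.Theory.
Import numFieldNormedType.Exports.

Local Open Scope classical_set_scope.
Local Open Scope ring_scope.

Section sup_norm.
Context {R : realType} {I : Type}.
Implicit Types (A : set I) (f g : I -> R).

Definition sup_norm A f : R := sup [set `|f i| | i in A].

Lemma sup_norm_ub A f (i : I) : A i ->
  has_ubound [set `|f i| | i in A] -> `|f i| <= sup_norm A f.
Proof. by move=> Ai fub; apply: ub_le_sup => //; exists i. Qed.

Lemma sup_norm_le A f (M : R) : A !=set0 ->
  (forall i, A i -> `|f i| <= M) -> sup_norm A f <= M.
Proof.
move=> [i Ai] fM; apply: ge_sup; first by exists `|f i|, i.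
by move=> _ [j Aj <-]; exact: fM.
Qed.

Lemma sup_normD A f g : A !=set0 ->
  has_ubound [set `|f i| | i in A] -> has_ubound [set `|g i| | i in A] ->
  sup_norm A (fun i => f i + g i) <= sup_norm A f + sup_norm A g.
Proof.
move=> A0 fub gub; apply: sup_norm_le => // i Ai.
by rewrite (le_trans (ler_normD _ _))// lerD// sup_norm_ub.
Qed.

Lemma sup_normZ A (a : R) f : A !=set0 -> has_ubound [set `|f i| | i in A] ->
  sup_norm A (fun i => a * f i) = `|a| * sup_norm A f.
Proof.
move=> A0 fub; have le_aM b h : has_ubound [set `|h i| | i in A] ->
    sup_norm A (fun i => b * h i) <= `|b| * sup_norm A h.
  move=> hub; apply: sup_norm_le => // i Ai.
  by rewrite normrM ler_wpM2l// sup_norm_ub.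
apply/eqP; rewrite eq_le le_aM//=.
have [->|a0] := eqVneq a 0.
  have [i Ai] := A0; rewrite normr0 mul0r; apply: le_trans (sup_norm_ub Ai _) => //.
  by exists 0 => _ [j _ <-]; rewrite mul0r normr0.
rewrite -ler_pdivlMl ?normr_gt0// -normfV.
have : has_ubound [set `|a * f i| | i in A].
  have [M fM] := fub; exists (`|a| * M) => _ [i Ai <-].
  by rewrite normrM ler_wpM2l// fM//; exists i.
move=> /(le_aM a^-1); apply: le_trans.
rewrite /sup_norm le_eqVlt; apply/orP; left; apply/eqP; congr sup.
by apply: eq_imagel => i _; rewrite mulKf.
Qed.

End sup_norm.

Section c0.
Context (R : realType).

Definition c0_pred : {pred nat -> R^o} :=
  mem [set u : nat -> R^o | u n @[n --> \oo] --> (0 : R^o)].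

Record c0 := C0 { c0_seq :> nat -> R^o ; _ : c0_seq \in c0_pred }.

HB.instance Definition _ := [isSub for c0_seq].
HB.instance Definition _ := [Choice of c0 by <:].

Let c0_submod : submod_closed c0_pred.
Proof.
split; first by apply/mem_set; exact: cvg_cst.
move=> a u v /set_mem u0 /set_mem v0; apply/mem_set => /=.
rewrite -[X in _ --> X](addr0 0) -[X in _ --> X + _](scaler0 _ a).
by apply: cvgD => //; exact: cvgZl_tmp.
Qed.

HB.instance Definition _ :=
  GRing.isSubmodClosed.Build R (nat -> R^o) c0_pred c0_submod.
HB.instance Definition _ := [SubChoice_isSubLmodule of c0 by <:].

Lemma c0_cvg (u : c0) : u n @[n --> \oo] --> (0 : R^o).
Proof. by case: u => u /= /set_mem. Qed.

Lemma c0_bounded (u : c0) : has_ubound [set `|u n| | n in [set: nat]].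
Proof.
have : cvgn (u : nat -> R^o) by apply/cvg_ex; exists 0; exact: c0_cvg.
move=> /cvg_seq_bounded [M [_ uM]]; exists (M + 1) => _ [n _ <-].
by apply: uM => //; rewrite ltrDl.
Qed.

Definition c0_norm (u : c0) : R := sup_norm [set: nat] u.

Let c0_normD (u v : c0) : c0_norm (u + v) <= c0_norm u + c0_norm v.
Proof. by apply: sup_normD; [exists 0|exact: c0_bounded..]. Qed.

Let c0_normZ (a : R) (u : c0) : c0_norm (a *: u) = `|a| * c0_norm u.
Proof. by apply: sup_normZ; [exists 0|exact: c0_bounded]. Qed.

Let c0_norm_eq0 (u : c0) : c0_norm u = 0 -> u = 0.
Proof.
move=> u0; apply/val_inj/funext => n /=; apply/eqP; rewrite -normr_le0 -u0.
by apply: sup_norm_ub => //; exact: c0_bounded.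
Qed.

HB.instance Definition _ :=
  Lmodule_isNormed.Build R c0 c0_normD c0_normZ c0_norm_eq0.

End c0.

Section l1.
Context (R : realType).

Definition l1_pred : {pred nat -> R^o} :=
  mem [set u : nat -> R^o | cvgn (series (fun n => `|u n|))].

Record l1 := L1 { l1_seq :> nat -> R^o ; _ : l1_seq \in l1_pred }.

HB.instance Definition _ := [isSub for l1_seq].
HB.instance Definition _ := [Choice of l1 by <:].

Let l1_submod : submod_closed l1_pred.
Proof.
split.
  apply/mem_set => /=; apply/cvg_ex; exists 0.
  rewrite [X in X @ _ --> _](_ : _ = fun=> 0); first exact: cvg_cst.
  by apply/funext => n; rewrite /series/= big1// => i _; rewrite normr0.
move=> a u v /set_mem/= u1 /set_mem/= v1; apply/mem_set => /=.
apply: (@series_le_cvg _ _ (fun n => `|a| * `|u n| + `|v n|)) => [n|n|n|].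
- exact: normr_ge0.
- by rewrite addr_ge0// mulr_ge0.
- by rewrite (le_trans (ler_normD _ _))// lerD2r normrM.
- have -> : (fun n => `|a| * `|u n| + `|v n|) =
    (`|a| *: (fun n => `|u n|) + (fun n => `|v n|) : nat -> R^o) by [].
  by apply: is_cvg_seriesD => //; exact: is_cvg_seriesZ.
Qed.

HB.instance Definition _ :=
  GRing.isSubmodClosed.Build R (nat -> R^o) l1_pred l1_submod.
HB.instance Definition _ := [SubChoice_isSubLmodule of l1 by <:].

Lemma l1_cvg (u : l1) : cvgn (series (fun n => `|u n|)).
Proof. by case: u => u /= /set_mem. Qed.

Definition l1_norm (u : l1) : R := limn (series (fun n => `|u n|)).

Let l1_normD (u v : l1) : l1_norm (u + v) <= l1_norm u + l1_norm v.
Proof.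
rewrite /l1_norm -lim_seriesD; [|exact: l1_cvg..].
apply: lim_series_le; first exact: l1_cvg.
  by apply: is_cvg_seriesD; exact: l1_cvg.
by move=> n; exact: ler_normD.
Qed.

Let l1_normZ (a : R) (u : l1) : l1_norm (a *: u) = `|a| * l1_norm u.
Proof.
rewrite /l1_norm -[RHS]lim_seriesZ; last exact: l1_cvg.
by congr (limn (series _)); apply/funext => n; exact: normrM.
Qed.

Let l1_norm_eq0 (u : l1) : l1_norm u = 0 -> u = 0.
Proof.
move=> u0; apply/val_inj/funext => n /=; apply/eqP; rewrite -normr_le0 -u0.
have le_lim := nondecreasing_cvgn_le _ (@l1_cvg u) n.+1.
apply: (le_trans _ (le_lim _)).
  by rewrite /series/= big_nat_recr//= lerDr sumr_ge0.
by apply: nondecreasing_series => i _ _; exact: normr_ge0.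
Qed.

HB.instance Definition _ :=
  Lmodule_isNormed.Build R l1 l1_normD l1_normZ l1_norm_eq0.

End l1.

Section dual.
Context (R : realType) (X : normedModType R).

Definition dual_pred : {pred X -> R^o} :=
  mem [set f : X -> R^o | linear f /\ continuous f].

Record dual := Dual { dual_fun :> X -> R^o ; _ : dual_fun \in dual_pred }.

HB.instance Definition _ := [isSub for dual_fun].
HB.instance Definition _ := [Choice of dual by <:].

Let dual_submod : submod_closed dual_pred.
Proof.
split.
  apply/mem_set; split => /=; last by move=> x; exact: cvg_cst.
  move=> a x y; have : (0 : R^o) = a *: 0 + 0 by rewrite scaler0 addr0.
  exact.
move=> a f g /set_mem/= [fl fc] /set_mem/= [gl gc]; apply/mem_set; split => /=.
  move=> b x y; have : a *: f (b *: x + y) + g (b *: x + y) =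
      b *: (a *: f x + g x) + (a *: f y + g y).
    by rewrite fl gl !scalerDr !scalerA (mulrC a b) addrACA.
  exact.
move=> x; apply: cvgD; last exact: gc.
by apply: cvgZl_tmp; exact: fc.
Qed.

HB.instance Definition _ :=
  GRing.isSubmodClosed.Build R (X -> R^o) dual_pred dual_submod.
HB.instance Definition _ := [SubChoice_isSubLmodule of dual by <:].

Lemma dual_linear (f : dual) : linear f.
Proof. by case: f => f /= /set_mem[]. Qed.

Lemma dual_continuous (f : dual) : continuous f.
Proof. by case: f => f /= /set_mem[]. Qed.

HB.instance Definition _ (f : dual) :=
  GRing.isLinear.Build R X R^o *:%R f (dual_linear f).

Lemma dual_bounded (f : dual) :
  has_ubound [set `|f x| | x in [set x | `|x| <= 1]].
Proof.
have /linear_bounded_continuous/linear_boundedP [M [_ fM]] := @dual_continuous f.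
have M1 : M < `|M| + 1 by rewrite ltr_pwDr// ler_norm.
exists (`|M| + 1) => _ [x /= x1 <-].
apply: le_trans (fM _ M1 x) _.
by rewrite ler_piMr// addr_ge0.
Qed.

Definition dual_norm (f : dual) : R := sup_norm [set x : X | `|x| <= 1] f.

Let ball0 : [set x : X | `|x| <= 1] !=set0.
Proof. by exists 0; rewrite /= normr0. Qed.

Let dual_normD (f g : dual) : dual_norm (f + g) <= dual_norm f + dual_norm g.
Proof. by apply: sup_normD => //; exact: dual_bounded. Qed.

Let dual_normZ (a : R) (f : dual) : dual_norm (a *: f) = `|a| * dual_norm f.
Proof. by apply: sup_normZ => //; exact: dual_bounded. Qed.

Let dual_norm_eq0 (f : dual) : dual_norm f = 0 -> f = 0.
Proof.
move=> f0; apply/val_inj/funext => x /=.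
have [->|x0] := eqVneq x 0; first by rewrite linear0.
have nx0 : `|x| != 0 by rewrite normr_eq0.
have : `|f (`|x|^-1 *: x)| <= 0.
  rewrite -f0; apply: sup_norm_ub; last exact: dual_bounded.
  by rewrite /= normrZ normfV normr_id mulVf.
rewrite normr_le0 linearZ/= scaler_eq0 invr_eq0 (negbTE nx0)/=.
by move=> /eqP.
Qed.

HB.instance Definition _ :=
  Lmodule_isNormed.Build R dual dual_normD dual_normZ dual_norm_eq0.

End dual.

Section embeddings.
Context {R : realType} {X Y : normedModType R}.

Definition coarse_lipschitz_embedding (f : X -> Y) : Prop :=
  exists A B C D : R, [/\ 0 < A, 0 < B, 0 < C, 0 < D &
    forall x y : X, A * `|x - y| - C <= `|f x - f y| <= B * `|x - y| + D].

Definition coarse_lipschitz_distortion_lt (f : X -> Y) (K : R) : Prop :=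
  exists A B C D : R, [/\ 0 < A, 0 < B, 0 < C, 0 < D & A * C < K /\
    forall x y : X, A^-1 * `|x - y| - B <= `|f x - f y| <= C * `|x - y| + D].

End embeddings.

Definition coarse_lipschitz_embeds_lt {R : realType} (X Y : normedModType R)
    (K : R) : Prop :=
  exists f : X -> Y,
    coarse_lipschitz_embedding f /\ coarse_lipschitz_distortion_lt f K.

(* T is a linear homeomorphism of Y onto its range, S giving the inverse. *)
Definition contains_isomorphic_copy {R : realType} (X Y : normedModType R) :
    Prop :=
  exists (T : {linear Y -> X}) (S : X -> Y),
    [/\ continuous T, cancel T S & {within range T, continuous S}].

(* Main.v *)
From HB Require Import structures.
Require Import Defs.
From mathcomp Require Import all_boot all_order all_algebra.
From mathcomp Require Import lra.
From mathcomp Require Import boolp classical_sets reals.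
From mathcomp Require Import topology normedtype sequences.

(** The idea is that the vertices of a large cube in c0 turn into functionals
    that take independent signs on a sequence of X.

    Let f : c0 -> X* satisfy the two estimates with constants A, B, C, D and
    A C < 2, let t be large, and write e_i for the unit vectors of c0.  A cube
    vertex v_s = t (s_0 e_0 + ... + s_(N-1) e_(N-1)), with signs s_j = 1 or -1,
    is at distance only t from 2 t s_i e_i, for every i < N: the coordinate i
    differs by t and the others are at most t.  The two spikes 2 t e_i and
    - 2 t e_i are at distance 4 t.  So there is a point x_i of the unit ball
    of X at which f(2 t e_i) - f(- 2 t e_i) is at least 4 t / A - B - 1, and
    for this x_i, which depends neither on s nor on N, the value at x_i of
    f(v_s) with s_i = 1 exceeds that of f(v_s') with s'_i = -1 by at least
      4 t / A - B - 1 - 2 (C t + D) = t (4 / A - 2 C) - (B + 2 D + 1),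
    which is 1 for a suitable t because A C < 2.

    Opposite vertices taken according to the signs of coefficients a_i then
    give a functional of norm at most 2 C t + D whose value at the sum of the
    a_i x_i is at least the sum of the |a_i| ([l1_lower_bound_of_signs]).
    Hence (x_i) spans a copy of l1 ([contains_l1_of_lower_bound]). *)

Import Order.TTheory GRing.Theory Num.Theory.
Import numFieldNormedType.Exports.
Local Open Scope classical_set_scope.
Local Open Scope ring_scope.

Set Implicit Arguments.
Unset Strict Implicit.
Unset Printing Implicit Defensive.

(** * Cube vertices and spikes in c0 *)

Lemma c0_norm_coord (R : realType) (u : c0 R) n : `|u n| <= `|u|.
Proof. exact: (sup_norm_ub _ (c0_bounded u)). Qed.

Lemma c0_norm_le (R : realType) (u : c0 R) (M : R) :
  (forall n, `|u n| <= M) -> `|u| <= M.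
Proof. by move=> uM; apply: sup_norm_le => //; exists 0%N. Qed.

Lemma c0_trunc_subproof (R : realType) (s : nat -> R) N :
  ((fun n => if (n < N)%N then s n else 0) : nat -> R^o) \in @c0_pred R.
Proof.
apply/mem_set => /=; apply: cvg_near_cst; exists N => // n /= Nn.
by rewrite ltnNge Nn.
Qed.

Definition c0_trunc (R : realType) (s : nat -> R) N : c0 R :=
  C0 (c0_trunc_subproof s N).

Definition cube_vertex (R : realType) (t : R) N (s : nat -> bool) : c0 R :=
  c0_trunc (fun n => (-1) ^+ s n * t) N.

Definition c0_spike (R : realType) (i : nat) (a : R) : c0 R :=
  c0_trunc (fun n => if n == i then a else 0) i.+1.

Lemma c0_spikeE (R : realType) i (a : R) n :
  c0_spike i a n = if n == i then a else 0.
Proof. by rewrite /=; have [->|] := eqVneq n i; [rewrite leqnn|case: ifP]. Qed.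

Lemma c0_subE (R : realType) (u v : c0 R) n : (u - v) n = u n - v n.
Proof. by []. Qed.

Lemma cube_vertex_dist (R : realType) (t : R) N s s' : 0 <= t ->
  `|cube_vertex t N s - cube_vertex t N s'| <= 2 * t.
Proof.
move=> t0; apply: c0_norm_le => n; rewrite c0_subE/=.
case: ifP => _; last by rewrite subr0 normr0 mulr_ge0.
apply: (le_trans (ler_normB _ _)).
by rewrite !normrM !normrX normrN1 !expr1n !mul1r ger0_norm// mulrDl mul1r.
Qed.

(** Doubling the [i]-th coordinate of a vertex and erasing the others moves
    every coordinate by at most [t]; that the spike only remembers the [i]-th
    sign is what makes the signs independent in the end. *)
Lemma cube_vertex_spike_dist (R : realType) (t : R) N s i :
  0 <= t -> (i < N)%N ->
  `|cube_vertex t N s - c0_spike i ((-1) ^+ s i * (2 * t))| <= t.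
Proof.
move=> t0 iN; apply: c0_norm_le => n.
rewrite c0_subE c0_spikeE/=.
have [->|_] := eqVneq n i.
  rewrite iN -mulrBr normrM normrX normrN1 expr1n mul1r ler_norml.
  by apply/andP; split; lra.
rewrite subr0; case: ifP => _; last by rewrite normr0.
by rewrite normrM normrX normrN1 expr1n mul1r ger0_norm.
Qed.

Lemma c0_spike_dist (R : realType) i (a b : R) :
  `|a - b| <= `|c0_spike i a - c0_spike i b|.
Proof.
have := c0_norm_coord (c0_spike i a - c0_spike i b) i.
by rewrite c0_subE !c0_spikeE eqxx.
Qed.

(** * From independent signs to a copy of l1 *)

Lemma dual_norm_apply (R : realType) (X : normedModType R) (f : dual X) x :
  `|f x| <= `|f| * `|x|.
Proof.
have [->|x0] := eqVneq x 0; first by rewrite linear0 !normr0 mulr0.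
have nx : 0 < `|x| by rewrite normr_gt0.
rewrite -ler_pdivrMr//.
have : `|f (`|x|^-1 *: x)| <= `|f|.
  apply: sup_norm_ub (dual_bounded f).
  by rewrite /= normrZ normfV normr_id mulVf// gt_eqF.
by rewrite linearZ/= normrZ normfV normr_id mulrC.
Qed.

Lemma dual_almost_norming (R : realType) (X : normedModType R) (f : dual X) e :
  e < `|f| -> exists x, `|x| <= 1 /\ e <= f x.
Proof.
move=> /sup_gt[].
  by exists `|f 0|, 0 => //=; rewrite normr0.
move=> _ [x /= x1 <-] efx; have [fx0|fx0] := leP 0 (f x).
  by exists x; split => //; move: efx; rewrite ger0_norm// => /ltW.
exists (- x); rewrite normrN linearN; split => //.
by move: efx; rewrite ltr0_norm// => /ltW.
Qed.

(** Only differences of values enter the separation hypothesis: testing the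
    sum against [h s - h s'] for the sign pattern [s] of [a] and its opposite
    [s'] makes every term [a i * (h s (x i) - h s' (x i))] at least [`|a i|],
    whatever the levels around which the values at [x i] are separated. *)
Lemma l1_lower_bound_of_signs (R : realType) (X : normedModType R) (N : nat)
    (h : (nat -> bool) -> dual X) (x : nat -> X) (M : R) :
  (forall s s', `|h s - h s'| <= M) ->
  (forall (s s' : nat -> bool) i, (i < N)%N -> ~~ s i -> s' i ->
    1 <= h s (x i) - h s' (x i)) ->
  forall a : nat -> R,
    \sum_(0 <= i < N) `|a i| <= M * `|\sum_(0 <= i < N) a i *: x i|.
Proof.
move=> hM sep a.
(* A vanishing coefficient contributes nothing: its sign is arbitrary. *)
pose s i := a i < 0; pose s' i := ~~ s i.
apply: (@le_trans _ _ ((h s - h s') (\sum_(0 <= i < N) a i *: x i))); last first.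
  apply: (le_trans (ler_norm _)); apply: (le_trans (dual_norm_apply _ _)).
  by rewrite ler_wpM2r.
rewrite linear_sum !big_mkord; apply: ler_sum => i _.
rewrite linearZ/= -[X in _ <= X]/(a i * (h s (x i) - h s' (x i))).
have [ai0|ai0] := leP 0 (a i).
  rewrite ger0_norm//; apply: ler_peMr => //.
  by apply: sep; rewrite /s' /s -?leNgt.
rewrite ltr0_norm// -mulrNN opprB; apply: ler_peMr; first by rewrite oppr_ge0 ltW.
by apply: sep; rewrite /s' /s ?negbK.
Qed.

Section l1_copy.
Context (R : realType) (X : completeNormedModType R) (x : nat -> X) (M : R).
Hypothesis x1 : forall i, `|x i| <= 1.
Hypothesis xM : forall (a : nat -> R) N,
  \sum_(0 <= i < N) `|a i| <= M * `|\sum_(0 <= i < N) a i *: x i|.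

Let T (a : l1 R) : X := limn (series (fun i => a i *: x i)).

Let norm_term (a : l1 R) i : `|a i *: x i| <= `|a i|.
Proof. by rewrite normrZ ler_piMr. Qed.

Let cvg_norm_terms (a : l1 R) : cvgn [normed series (fun i => a i *: x i)].
Proof. exact: series_le_cvg (norm_term a) (@l1_cvg _ a). Qed.

Let cvg_terms (a : l1 R) : cvgn (series (fun i => a i *: x i)).
Proof. exact/normed_cvg/cvg_norm_terms. Qed.

Let T_linear : linear T.
Proof.
move=> c a b; rewrite /T -limZl_tmp; last exact: cvg_terms.
rewrite -limD; [|by apply: is_cvgZl_tmp; exact: cvg_terms|exact: cvg_terms].
congr (limn _); apply/funext => n.
rewrite [RHS](_ : _ = c *: (\sum_(0 <= i < n) a i *: x i) +
  \sum_(0 <= i < n) b i *: x i)// scaler_sumr -big_split/=.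
by apply: eq_bigr => i _; rewrite scalerA -scalerDl.
Qed.

HB.instance Definition _ := GRing.isLinear.Build R (l1 R) X *:%R T T_linear.

Let T_le (a : l1 R) : `|T a| <= `|a|.
Proof.
rewrite /T; apply: le_trans (lim_series_norm _) _; first exact: cvg_norm_terms.
rewrite -[leRHS]/(l1_norm a) /l1_norm.
apply: lim_series_le (norm_term a); first exact: cvg_norm_terms.
exact: l1_cvg.
Qed.

Let T_ge (a : l1 R) : `|a| <= M * `|T a|.
Proof.
rewrite -[leLHS]/(l1_norm a) /l1_norm /T.
have cM : M * `|series (fun i => a i *: x i) n| @[n --> \oo] -->
    M * `|limn (series (fun i => a i *: x i))|.
  by apply: cvgM; [exact: cvg_cst|apply: cvg_norm; exact: cvg_terms].
apply: (ler_cvg_to (@l1_cvg _ a) cM).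
by apply: nearW => n; exact: xM.
Qed.

(** The map sending [a] to the sum of the [a i *: x i] is contractive and, by
    passing to the limit in the lower bound on finite sums, satisfies
    [`|a - b| <= M * `|T a - T b|]; so it is injective and its inverse is
    Lipschitz on the range. *)
Lemma contains_l1_of_lower_bound : contains_isomorphic_copy X (l1 R).
Proof.
have T_inj : injective T.
  move=> a b Tab; apply/eqP; rewrite -subr_eq0 -normr_le0.
  by rewrite (le_trans (T_ge _))// linearB/= Tab subrr normr0 mulr0.
pose S y := xget 0 [set a | T a = y].
have TK : cancel T S.
  by move=> a; rewrite /S; case: xgetP => [b _ Tb|/(_ a) /(_ erefl)] //; apply: T_inj.
have Tb (a b : l1 R) : `|a - b| <= M * `|T a - T b| by rewrite -linearB T_ge.
exists T, S; split => //.
  apply: bounded_linear_continuous; apply/linear_boundedP; near=> r => a.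
  by rewrite (le_trans (T_le a))// ler_peMl//; near: r; exact: nbhs_pinfty_ge.
(* [`|M| + 1] replaces [M] only to have a divisor that is visibly positive. *)
apply/subspace_continuousP => _ [a _ <-].
rewrite /from_subspace TK.
have M1 : 0 < `|M| + 1 by rewrite ltr_pwDr.
apply/cvgrPdist_le => e e0; near=> y.
have [b _ yE] : range T y by near: y; exact: withinT.
rewrite -yE TK; apply: le_trans (Tb a b) _; rewrite yE.
apply: (@le_trans _ _ ((`|M| + 1) * `|T a - y|)).
  by rewrite ler_wpM2r// (le_trans (ler_norm M))// lerDl.
rewrite -ler_pdivlMl//; near: y.
apply: (@cvgr_dist_le _ _ _ _ _ id); last by rewrite mulr_gt0 ?invr_gt0.
exact: cvg_within.
Unshelve. all: by end_near. Qed.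
End l1_copy.

(** * Distortion less than 2 *)

(** The threshold 2 is the ratio of the distance 4 t between the spikes at
    [2 * t] and [- (2 * t)] to twice the distance t from a spike to the cube
    vertices of its sign. *)
Lemma contains_l1_of_distortion_lt2 (R : realType)
    (X : completeNormedModType R) (f : c0 R -> dual X) :
  coarse_lipschitz_distortion_lt f 2 -> contains_isomorphic_copy X (l1 R).
Proof.
move=> [A [B [C [D [A0 B0 C0 D0 [AC fd]]]]]].
have gap : 0 < 4 * A^-1 - 2 * C.
  by rewrite subr_gt0 ltr_pdivlMr//; lra.
(* The scale at which the gap 4 t / A - 2 C t absorbs B and D with 1 to spare. *)
pose t := (B + 2 * D + 2) / (4 * A^-1 - 2 * C).
have t0 : 0 <= t by rewrite divr_ge0 ?ltW//; lra.
have tE : t * (4 * A^-1 - 2 * C) = B + 2 * D + 2 by rewrite divfK ?gt_eqF.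
have flip (u v : c0 R) K : `|u - v| <= K -> `|f u - f v| <= C * K + D.
  move=> uv; have /andP[_ /le_trans->]// := fd u v.
  by rewrite lerD2r ler_wpM2l// ltW.
pose F i := f (c0_spike i (2 * t)) - f (c0_spike i (- (2 * t))).
have /choice[x xP] i :
    exists x : X, `|x| <= 1 /\ A^-1 * (4 * t) - B - 1 <= F i x.
  apply: dual_almost_norming; apply: (@lt_le_trans _ _ (A^-1 * (4 * t) - B)).
    by rewrite ltrBlDr ltrDl.
  have /andP[+ _] := fd (c0_spike i (2 * t)) (c0_spike i (- (2 * t))).
  apply: le_trans; rewrite lerD2r ler_pM2l ?invr_gt0//.
  apply: le_trans (c0_spike_dist _ _ _); apply: le_trans (ler_norm _); lra.
apply: (@contains_l1_of_lower_bound _ _ x (C * (2 * t) + D)).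
  by move=> i; case: (xP i).
move=> a N.
apply: (l1_lower_bound_of_signs (h := fun s => f (cube_vertex t N s))).
  by move=> s s'; exact/flip/cube_vertex_dist.
move=> s s' i iN si s'i; have [xi1 xiF] := xP i.
have near_spike r :
    `|f (cube_vertex t N r) (x i) - f (c0_spike i ((-1) ^+ r i * (2 * t))) (x i)|
    <= C * t + D.
  have := flip _ _ _ (cube_vertex_spike_dist r t0 iN).
  apply: le_trans.
  rewrite -[X in `|X|]/((f (cube_vertex t N r) -
    f (c0_spike i ((-1) ^+ r i * (2 * t)))) (x i)).
  by apply: le_trans (dual_norm_apply _ _) _; rewrite ler_piMr.
have := near_spike s; have := near_spike s'.
rewrite s'i (negbTE si) expr0 expr1 mul1r mulN1r !ler_norml.
move=> /andP[_ le1] /andP[le2 _].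
rewrite -[F i _]/(f (c0_spike i (2 * t)) (x i) - f (c0_spike i (- (2 * t))) (x i)) in xiF.
lra.
Qed.

Theorem theorem6p2 (R : realType) (X : completeNormedModType R) :
  coarse_lipschitz_embeds_lt (c0 R) (dual X) (3 / 2) ->
  contains_isomorphic_copy X (l1 R).
Proof.
move=> [f [_ [A [B [C [D [A0 B0 C0 D0 [AC fd]]]]]]]].
apply: (@contains_l1_of_distortion_lt2 _ _ f); exists A, B, C, D.
by split => //; split => //; lra.
Qed.
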